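(* Let $K$ be a $\Gamma$-invariant $\boldsymbol H$-operator valued kernel on $X$ which is partially positive semidefinite with respect to the partition $P_a=\{X_s\}_{s\in S}$. Let $K^s=K|_{X_s\times X_s}$ and let $\boldsymbol R=\{\mathcal R_{K^s}\}_{s\in S}$, where $\mathcal R_{K^s}$ is the reproducing kernel Hilbert space of $K^s$. The following assertions are equivalent. (1) $K$ is of bounded shift type. (2) There exists a unique $*$-representation $(\mathrm{Id}_S,\Phi)$, $\Phi\colon\Gamma\to\Gamma_{\boldsymbol R}$, such that $K^{c(\alpha)}_{\alpha\cdot x}=\Phi(\alpha)K^{d(\alpha)}_x$ for all $\alpha\in\Gamma$ and $x\in X_{d(\alpha)}$. (3) There exists a minimal $\Gamma$-invariant Hilbert space linearisation $(\boldsymbol K;\boldsymbol V;\Psi)$ of $K$, which is unique modulo unitary equivalence in the following sense: whenever $(\boldsymbol K';\boldsymbol V';\Psi')$ is another minimal $\Gamma$-invariant Hilbert space linearisation of $K$, there exists a bundle of unitary operators $\boldsymbol U=\{U_s\}_{s\in S}$ such that (a) $U_s\colon\mathcal K_s\to\mathcal K'_s$ for all $s\in S$; (b) $U_{c(\alpha)}\Psi(\alpha)=\Psi'(\alpha)U_{d(\alpha)}$ for all $\alpha\in\Gamma$; (c) $U_{a(x)}V_x=V'_x$ for all $x\in X$.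
   Context: $\mathbb F$ is $\mathbb R$ or $\mathbb C$. $\mathcal B(\mathcal H,\mathcal G)$ is the space of bounded linear operators. Semigroupoids. A semigroupoid $(\Gamma;S;d;c;\cdot)$ consists of nonempty sets $\Gamma$ and $S$ (the set of symbols), maps $d,c\colon\Gamma\to S$ (domain and codomain maps), and a product $\alpha\beta\in\Gamma$ defined whenever $d(\alpha)=c(\beta)$ (the set of such pairs is $\Gamma^{(2)}$), with $d(\alpha\beta)=d(\beta)$, $c(\alpha\beta)=c(\alpha)$, and $\alpha(\beta\gamma)=(\alpha\beta)\gamma$ whenever $d(\alpha)=c(\beta)$, $d(\beta)=c(\gamma)$. Put $\Gamma_s=\{\alpha\mid d(\alpha)=s\}$, $\Gamma^t=\{\alpha\mid c(\alpha)=t\}$, $\Gamma_s^t=\Gamma_s\cap\Gamma^t$. A $*$-semigroupoid is a semigroupoid with a map $\alpha\mapsto\alpha^*$ such that $d(\alpha^* )=c(\alpha)$, $c(\alpha^* )=d(\alpha)$, $(\alpha\beta)^*=\beta^*\alpha^*$ for $(\alpha,\beta)\in\Gamma^{(2)}$, and $(\alpha^* )^*=\alpha$. No unit is assumed. A left action $(a;\cdot)$ of $\Gamma$ on a nonempty set $X$ consists of a surjective map $a\colon X\to S$ (the anchor) and, for each $x\in X$ and $\alpha\in\Gamma_{a(x)}$, an element $\alpha\cdot x\in X$ with $a(\alpha\cdot x)=c(\alpha)$, such that $(\alpha\beta)\cdot x=\alpha\cdot(\beta\cdot x)$ for $(\alpha,\beta)\in\Gamma^{(2)}$, $\beta\in\Gamma_{a(x)}$.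 Setting. $\Gamma$ is a $*$-semigroupoid with symbol set $S$, $(a;\cdot)$ is a left action of $\Gamma$ on the nonempty set $X$, $X_s=a^{-1}(\{s\})$, $P_a=\{X_s\}_{s\in S}$. $\boldsymbol H=\{\mathcal H_x\}_{x\in X}$ is a bundle (family) of Hilbert spaces over $\mathbb F$ such that $\mathcal H_{\alpha\cdot x}=\mathcal H_x$ for all $x\in X$, $\alpha\in\Gamma_{a(x)}$. $\boldsymbol H_s=\{\mathcal H_x\}_{x\in X_s}$. $\mathcal F_{\mathbb F}(X_s;\boldsymbol H_s)=\prod_{x\in X_s}\mathcal H_x$ is the vector space of sections ($f_x=f(x)\in\mathcal H_x$), and $\mathcal F^0_{\mathbb F}(X_s;\boldsymbol H_s)$ its subspace of sections with finite support. An $\boldsymbol H$-operator valued kernel $K$ on $X$ is a map on $X\times X$ with $K(x,y)\in\mathcal B(\mathcal H_y,\mathcal H_x)$. $K$ is $\Gamma$-invariant if $K(\alpha\cdot x,y)=K(x,\alpha^*\cdot y)$ for all $x,y\in X$ and $\alpha\in\Gamma_{a(x)}^{a(y)}$. $K$ is partially positive semidefinite with respect to $P_a$ if for every $s\in S$, $K(x,y)^*=K(y,x)$ for $x,y\in X_s$, and $\sum_{i,j=1}^n\langle K(x_j,x_i)h_i,h_j\rangle_{\mathcal H_{x_j}}\ge0$ for all $n\in\mathbb N$, $x_1,\dots,x_n\in X_s$, $h_i\in\mathcal H_{x_i}$. $K$ is of bounded shift type if for all $\alpha\in\Gamma$ there is $M_\alpha\ge0$ such that for every $g\in\mathcal F^0_{\mathbb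 F}(X_{d(\alpha)};\boldsymbol H_{d(\alpha)})$, $$\sum_{x,y\in X_{d(\alpha)}}\langle K(\alpha\cdot x,\alpha\cdot y)g_y,g_x\rangle_{\mathcal H_x}\le M_\alpha\sum_{x,y\in X_{d(\alpha)}}\langle K(x,y)g_y,g_x\rangle_{\mathcal H_x}.$$ Reproducing kernel Hilbert spaces. For $x\in X_s$, $h\in\mathcal H_x$, $K^s_xh=K^s(\cdot,x)h$. $\mathcal R_{K^s}$ is the (unique) Hilbert space which is a linear subspace of $\mathcal F_{\mathbb F}(X_s;\boldsymbol H_s)$, contains all $K^s_xh$, and satisfies $\langle f(x),h\rangle_{\mathcal H_x}=\langle f,K^s_xh\rangle_{\mathcal R_{K^s}}$ for all $f\in\mathcal R_{K^s}$, $x\in X_s$, $h\in\mathcal H_x$. $K^s_x$ is regarded as a bounded operator $\mathcal H_x\to\mathcal R_{K^s}$. Representations. For a bundle of Hilbert spaces $\boldsymbol K=\{\mathcal K_s\}_{s\in S}$, $\Gamma_{\boldsymbol K}=\bigsqcup_{s,t\in S}\mathcal B(\mathcal K_s,\mathcal K_t)$ is a $*$-semigroupoid under composition and Hilbert space adjoint. A $*$-representation $(\mathrm{Id}_S,\Phi)$ of $\Gamma$ on $\Gamma_{\boldsymbol K}$ is a map $\Phi\colon\Gamma\to\Gamma_{\boldsymbol K}$ with $\Phi(\alpha)\in\mathcal B(\mathcal K_{d(\alpha)},\mathcal K_{c(\alpha)})$, $\Phi(\alpha\beta)=\Phi(\alpha)\Phi(\beta)$ for $(\alpha,\beta)\in\Gamma^{(2)}$,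 and $\Phi(\alpha^* )=\Phi(\alpha)^*$. A $\Gamma$-invariant Hilbert space linearisation of $K$ is a triple $(\boldsymbol K;\boldsymbol V;\Psi)$ with: (IL1) $\boldsymbol K=\{\mathcal K_s\}_{s\in S}$ a bundle of Hilbert spaces; (IL2) $\boldsymbol V=\{V_x\}_{x\in X}$, $V_x\in\mathcal B(\mathcal H_x,\mathcal K_{a(x)})$, with $K(x,y)=V_x^*V_y$ for all $x,y$ with $a(x)=a(y)$; (IL3) $(\mathrm{Id}_S;\Psi)$ a $*$-representation of $\Gamma$ on $\Gamma_{\boldsymbol K}$ with $\Psi(\alpha)V_x=V_{\alpha\cdot x}$ for all $x\in X$, $\alpha\in\Gamma_{a(x)}$. It is minimal if (IL4) each $\mathcal K_s$ is the closed span of $\{V_x\mathcal H_x\mid x\in X,\ a(x)=s\}$. *)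

(* Defs.v *)
From HB Require Import structures.
From mathcomp Require Import all_boot all_order all_algebra.
From mathcomp Require Import all_classical all_reals all_analysis.
From mathcomp.real_closed Require Import complex.
From mathcomp Require Import ring.

Set Implicit Arguments.
Unset Strict Implicit.
Unset Printing Implicit Defensive.

Import Order.TTheory GRing.Theory Num.Theory.
Import numFieldNormedType.Exports.

Local Open Scope classical_set_scope.
Local Open Scope ring_scope.

Variant scalar_kind := real_scalars | complex_scalars.

Definition scalar (R : realType) (k : scalar_kind) : numFieldType :=
  match k with
  | real_scalars => R
  | complex_scalars => R[i]
  end.

Definition scalar_conj (R : realType) (k : scalar_kind) :
    {rmorphism scalar R k -> scalar R k} :=
  match k with
  | real_scalars => (idfun : {rmorphism R -> R})
  | complex_scalars => (Num.conj : {rmorphism R[i] -> R[i]})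
  end.

(* The inner product is linear in its first argument. On R[i] the order of
   mathcomp is partial: [0 <= z] means that z is real and nonnegative. *)
Record hilbert (R : realType) (k : scalar_kind) := Hilbert {
  hspace :> completeNormedModType (scalar R k);
  hdot : {dot hspace for scalar_conj R k};
  hdot_norm : forall v : hspace, `|v| ^+ 2 = hdot v v }.

Notation "<| u , v |>" := (hdot _ u v) (format "<|  u ,  v  |>").

Record bop (R : realType) (k : scalar_kind) (V W : hilbert R k) := Bop {
  bop_fun :> {linear V -> W};
  bop_bounded : exists2 M : scalar R k,
    0 <= M & forall v : V, `|bop_fun v| <= M * `|v| }.

Section Operators.
Variables (R : realType) (k : scalar_kind).
Implicit Types U V W : hilbert R k.

Lemma bop_comp_subproof U V W (T : bop V W) (S : bop U V) :
  exists2 M : scalar R k,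
    0 <= M & forall u : U, `|(T \o S) u| <= M * `|u|.
Proof.
have [M M0 hM] := bop_bounded T; have [N N0 hN] := bop_bounded S.
exists (M * N) => [|u /=]; first exact: mulr_ge0.
by rewrite (le_trans (hM _)) // -mulrA ler_wpM2l.
Qed.

Definition bop_comp U V W (T : bop V W) (S : bop U V) : bop U W :=
  @Bop R k U W (T \o S) (bop_comp_subproof T S).

(* The spaces H_(a.x) and H_x, or those indexed by dom (a b) and dom b, are
   only propositionally equal: operators are transported along equalities. *)
Definition bop_cast V V' W W' (eV : V = V') (eW : W = W') :
    bop V W -> bop V' W' :=
  match eV in _ = V1, eW in _ = W1 return bop V W -> bop V1 W1 with
  | erefl, erefl => id
  end.

Definition is_adjoint V W (T : bop V W) (S : bop W V) : Prop :=
  forall (v : V) (w : W), <| T v, w |> = <| v, S w |>.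

Definition unitary V W (T : bop V W) : Prop :=
  exists S : bop W V, [/\ is_adjoint T S, cancel T S & cancel S T].

Definition lin_span V (A : set V) : set V :=
  [set v | exists n (c : 'I_n -> scalar R k) (w : 'I_n -> V),
     (forall i, A (w i)) /\ v = \sum_(i < n) c i *: w i].

End Operators.

Notation "T \oB S" := (bop_comp T S) (at level 40, left associativity).

Definition op_kernel (R : realType) (k : scalar_kind) (X : Type)
  (H : X -> hilbert R k) := forall x y : X, bop (H y) (H x).

Definition pos_semidef (R : realType) (k : scalar_kind) (X : Type)
    (H : X -> hilbert R k) (K : op_kernel H) : Prop :=
  (forall x y, is_adjoint (K x y) (K y x)) /\
  (forall n (x : 'I_n -> X) (h : forall i, H (x i)),
     0 <= \sum_(i < n) \sum_(j < n) <| K (x j) (x i) (h i), h j |>).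

(* [rk_eval] embeds the space as a linear subspace of the space of sections
   [forall x, H x]; [rk_kern x h] is the element whose section is
   [K(., x) h]. *)
Record rkhs (R : realType) (k : scalar_kind) (X : Type)
    (H : X -> hilbert R k) (K : op_kernel H) := Rkhs {
  rk_space :> hilbert R k;
  rk_eval : rk_space -> forall x, H x;
  rk_eval_linear : forall (c : scalar R k) (f g : rk_space) x,
    rk_eval (c *: f + g) x = c *: rk_eval f x + rk_eval g x;
  rk_eval_inj : forall f g : rk_space,
    (forall x, rk_eval f x = rk_eval g x) -> f = g;
  rk_kern : forall x, H x -> rk_space;
  rk_kernE : forall x (h : H x) y, rk_eval (rk_kern h) y = K y x h;
  rk_reproducing : forall (f : rk_space) x (h : H x),
    <| rk_eval f x, h |> = <| f, rk_kern h |> }.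

Section KernelOperator.
Variables (R : realType) (k : scalar_kind) (X : Type).
Variables (H : X -> hilbert R k) (K : op_kernel H) (E : rkhs K) (x : X).

Fact rk_kern_linear : linear (@rk_kern _ _ _ _ _ E x).
Proof.
move=> c h h'; apply: (@rk_eval_inj _ _ _ _ _ E) => y.
by rewrite rk_eval_linear !rk_kernE linearP.
Qed.

HB.instance Definition _ :=
  GRing.isLinear.Build (scalar R k) (H x) E _ (@rk_kern _ _ _ _ _ E x)
    rk_kern_linear.

Fact rk_kern_bounded : exists2 M : scalar R k,
  0 <= M & forall h : H x, `|@rk_kern _ _ _ _ _ E x h| <= M * `|h|.
Proof.
have [M M0 hM] := bop_bounded (K x x).
exists (M ^+ 2 + 1) => [|h]; first by rewrite addr_ge0 // exprn_ge0.
set w := rk_kern E h; set a := K x x h.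
have wE : `|w| ^+ 2 = <| a, h |>.
  by rewrite hdot_norm -rk_reproducing rk_kernE.
have wE' : `|w| ^+ 2 = <| h, a |>.
  rewrite hdot_norm (hermC (hdot E)) /= expr0 mul1r -hdot_norm wE.
  by rewrite (hermC (hdot (H x)) h a) /= expr0 mul1r.
have w2 : `|w| ^+ 2 + `|w| ^+ 2 <= `|a| ^+ 2 + `|h| ^+ 2.
  rewrite -subr_ge0 {1}wE wE'.
  suff -> : `|a| ^+ 2 + `|h| ^+ 2 - (<| a, h |> + <| h, a |>) = `|a - h| ^+ 2.
    exact: exprn_ge0.
  rewrite !hdot_norm linearBl !linearBr /= !opprD opprK. ring.
have ah : `|a| ^+ 2 + `|h| ^+ 2 <= (M ^+ 2 + 1) * `|h| ^+ 2.
  by rewrite mulrDl mul1r lerD2r -exprMn lerXn2r ?nnegrE ?mulr_ge0 ?hM.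
have w1 : `|w| ^+ 2 <= (M ^+ 2 + 1) * `|h| ^+ 2.
  apply: le_trans ah; apply: le_trans w2.
  by rewrite lerDl exprn_ge0.
have MM : 1 <= M ^+ 2 + 1 by rewrite lerDr exprn_ge0.
rewrite -(@ler_pXn2r _ 2) ?nnegrE ?mulr_ge0 ?addr_ge0 ?exprn_ge0 //.
apply: le_trans w1 _; rewrite exprMn ler_wpM2r ?exprn_ge0 //.
by rewrite expr2 ler_peMr // (le_trans ler01).
Qed.

Definition rk_op : bop (H x) E :=
  @Bop R k (H x) E (@rk_kern _ _ _ _ _ E x) rk_kern_bounded.

End KernelOperator.

Record semigroupoid := Semigroupoid {
  arrow :> Type;
  symb : Type;
  arrow_inh : inhabited arrow;
  symb_inh : inhabited symb;
  dom : arrow -> symb;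
  cod : arrow -> symb;
  mul : forall a b : arrow, dom a = cod b -> arrow;
  dom_mul : forall a b (p : dom a = cod b), dom (mul p) = dom b;
  cod_mul : forall a b (p : dom a = cod b), cod (mul p) = cod a;
  mulA : forall a b c (p : dom a = cod b) (q : dom b = cod c)
    (p' : dom a = cod (mul q)) (q' : dom (mul p) = cod c),
    mul p' = mul q' }.

Record star_semigroupoid := StarSemigroupoid {
  sgpd :> semigroupoid;
  star : sgpd -> sgpd;
  dom_star : forall a, dom (star a) = cod a;
  cod_star : forall a, cod (star a) = dom a;
  star_mul : forall a b (p : dom a = cod b)
    (p' : dom (star b) = cod (star a)), star (mul p) = mul p';
  starK : forall a, star (star a) = a }.

Record left_action (G : semigroupoid) (X : Type) := LeftAction {
  act_inh : inhabited X;
  anchor : X -> symb G;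
  anchor_surj : forall s, exists x, anchor x = s;
  act : forall (a : G) (x : X), anchor x = dom a -> X;
  anchor_act : forall a x (e : anchor x = dom a), anchor (act e) = cod a;
  act_mul : forall a b (p : dom a = cod b) x (e : anchor x = dom b)
    (e' : anchor x = dom (mul p)) (e'' : anchor (act e) = dom a),
    act e' = act e'' }.

Definition fiber (G : semigroupoid) (X : Type) (A : left_action G X)
  (s : symb G) := {x : X | anchor A x = s}.

Definition fiber_act (G : semigroupoid) (X : Type) (A : left_action G X)
    (a : G) (x : fiber A (dom a)) : fiber A (cod a) :=
  exist _ (act (svalP x)) (anchor_act (svalP x)).

Definition is_star_rep (R : realType) (k : scalar_kind)
    (G : star_semigroupoid) (B : symb G -> hilbert R k)
    (Phi : forall a : G, bop (B (dom a)) (B (cod a))) : Prop :=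
  (forall (a b : G) (p : dom a = cod b),
     bop_cast (congr1 B (dom_mul p)) (congr1 B (cod_mul p)) (Phi (mul p)) =
     Phi a \oB bop_cast erefl (congr1 B (esym p)) (Phi b)) /\
  (forall a : G,
     is_adjoint (Phi a)
       (bop_cast (congr1 B (dom_star a)) (congr1 B (cod_star a))
          (Phi (star a)))).
Arguments is_star_rep {R k G} B Phi.

Definition invariant_bundle (R : realType) (k : scalar_kind)
    (G : semigroupoid) (X : Type) (A : left_action G X)
    (H : X -> hilbert R k) : Prop :=
  forall (a : G) (x : X) (e : anchor A x = dom a), H (act e) = H x.

Section InvariantKernels.
Variables (R : realType) (k : scalar_kind) (G : star_semigroupoid).
Variables (X : Type) (A : left_action G X) (H : X -> hilbert R k).
Variables (HA : invariant_bundle A H) (K : op_kernel H).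

Definition invariant_kernel : Prop :=
  forall (a : G) (x y : X) (ex : anchor A x = dom a)
    (ey : anchor A y = cod a),
    let ey' : anchor A y = dom (star a) := etrans ey (esym (dom_star a)) in
    bop_cast erefl (HA ex) (K (act ex) y) =
    bop_cast (HA ey') erefl (K x (act ey')).

Definition kernel_on (s : symb G) :
    op_kernel (fun x : fiber A s => H (sval x)) :=
  fun x y => K (sval x) (sval y).
Arguments kernel_on s : clear implicits.

Definition partially_pos_semidef : Prop :=
  forall s : symb G, pos_semidef (kernel_on s).

(* The sums range over the finite support of [g]; [{classic _}] equips the
   index type with the choice structure that the finitely supported sums of
   the library ask for. *)
Definition bounded_shift_type : Prop :=
  forall a : G, exists2 M : scalar R k, 0 <= M &
    forall g : (forall x : fiber A (dom a), H (sval x)),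
      finite_set [set x | g x != 0] ->
      \sum_(x \in [set: {classic fiber A (dom a)}])
        \sum_(y \in [set: {classic fiber A (dom a)}])
          <| bop_cast (HA (svalP y)) (HA (svalP x))
                (K (act (svalP x)) (act (svalP y))) (g y), g x |>
      <= M * \sum_(x \in [set: {classic fiber A (dom a)}])
               \sum_(y \in [set: {classic fiber A (dom a)}])
                 <| K (sval x) (sval y) (g y), g x |>.

Record invariant_linearisation := InvariantLinearisation {
  lin_space : symb G -> hilbert R k;
  lin_op : forall x, bop (H x) (lin_space (anchor A x));
  lin_rep : forall a : G, bop (lin_space (dom a)) (lin_space (cod a));
  lin_kernel : forall x y (e : anchor A y = anchor A x),
    exists2 Vx_adj : bop (lin_space (anchor A x)) (H x),
      is_adjoint (lin_op x) Vx_adj &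
      K x y = Vx_adj \oB bop_cast erefl (congr1 lin_space e) (lin_op y);
  lin_rep_star : is_star_rep lin_space lin_rep;
  lin_equivariant : forall (a : G) x (e : anchor A x = dom a),
    lin_rep a \oB bop_cast erefl (congr1 lin_space e) (lin_op x) =
    bop_cast (HA e) (congr1 lin_space (anchor_act e)) (lin_op (act e)) }.

Definition minimal (L : invariant_linearisation) : Prop :=
  forall s : symb G,
    closure (lin_span
      [set v : lin_space L s | exists (x : fiber A s) (h : H (sval x)),
         v = bop_cast erefl (congr1 (lin_space L) (svalP x))
               (lin_op L (sval x)) h]) = setT.

Definition unitarily_equivalent (L L' : invariant_linearisation) : Prop :=
  exists U : forall s, bop (lin_space L s) (lin_space L' s),
    [/\ forall s, unitary (U s),
        forall a : G, U (cod a) \oB lin_rep L a = lin_rep L' a \oB U (dom a) &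
        forall x, U (anchor A x) \oB lin_op L x = lin_op L' x].

End InvariantKernels.

Arguments kernel_on {R k G X} A {H} K s.

(* Main.v *)
From HB Require Import structures.
From mathcomp Require Import all_boot all_order all_algebra finmap.
From mathcomp Require Import all_classical all_reals all_analysis.
From mathcomp.real_closed Require Import complex.
From mathcomp Require Import ring.
Require Import Defs.

Set Implicit Arguments.
Unset Strict Implicit.
Unset Printing Implicit Defensive.

Import Order.TTheory GRing.Theory Num.Theory.
Import numFieldNormedType.Exports.

Local Open Scope classical_set_scope.
Local Open Scope ring_scope.

(** The three conditions are linked by one device, a frame: for every symbol [s]
    a Hilbert space [B s] together with bounded operators [F s x : H x -> B s],
    for [x] in the fiber over [s]. The frames of interest factor the kernel,
    [<| F s y h, F s x h' |> = <| K x y h, h' |>] ([has_gram]): this holds for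
    the sections [K(., x) h] in the reproducing kernel spaces and for the
    vectors [V_x h] of an invariant linearisation. When the vectors of such a
    frame are total, meaning that they span a dense subspace of each [B s],
    they carry all the information needed:

    - For a finitely supported section [g], the two double sums in the bounded
      shift condition are [|sum_x F (a . x) (g x)|^2] and
      [|sum_x F x (g x)|^2] ([shift_norm] and [frame_norm]). So bounded shift
      says exactly that [F x h |-> F (a . x) h] is well defined and bounded on
      the span of the frame. For a total frame this map extends by continuity
      ([bounded_extension]) to an operator [Phi a], and it is the only one.
      Conversely, an operator with [Phi a (F x h) = F (a . x) h] gives the
      bound, with its squared norm bound as constant.

    - Such operators automatically form a star representation
      ([star_rep_of_equivariant]): multiplicativity is that of the action,
      and [<| F (a . x) h, F y h' |> = <| F x h, F (a^* . y) h' |>] is the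
      invariance of the kernel read through the inner products of the frame.

    - Two total frames have the same inner products, so
      [F s x h |-> F' s x h] extends to a unitary ([unitary_of_gram]); it
      intertwines the representations since it does so on frame vectors. This
      is the uniqueness of minimal linearisations.

    The kernel sections are total in the reproducing kernel space because the
    reproducing property makes an [f] orthogonal to all of them vanish
    pointwise; [total_orthogonal] turns this into density by the classical
    argument that a minimizing sequence for the distance to a subspace
    converges to an orthogonal projection.

    The spaces [H (a . x)] and [H x] are only propositionally equal, so
    vectors are carried along equalities by [transport]. All these transports
    are absorbed by [frame_transport], which says that a frame vector depends on
    its point and its symbol only, not on the proofs attached to them. *)

(** * Real and complex scalars *)

Section Scalars.
Variables (R : realType) (k : scalar_kind).
Local Notation S := (scalar R k).

Lemma scalar_conjM (z : S) : scalar_conj R k z * z = `|z| ^+ 2.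
Proof.
case: k z => z /=; first by rewrite real_normK ?num_real // expr2.
by rewrite mulrC -normCK.
Qed.

(** The only place where the completeness of the real line enters: complex
    scalars are partially ordered, but nonnegative ones are real, so the
    infimum is taken on real parts. *)
Lemma nonneg_infimum (D : set S) : D !=set0 -> (forall x, D x -> 0 <= x) ->
  exists d : S, [/\ 0 <= d, forall x, D x -> d <= x &
    forall e, 0 < e -> exists2 x, D x & x < d + e].
Proof.
case: k D => D [x0 Dx0] D0 /=.
  have hD : has_inf D by split; [exists x0 | exists 0 => x /D0].
  exists (inf D); split; first by apply: lb_le_inf; [exists x0 | move=> x /D0].
    by move=> x Dx; apply: ge_inf => //; exact: hD.2.
  by move=> e e0; have [x Dx xe] := inf_adherent e0 hD; exists x.
pose D' := [set r : R | D (r%:C)%C].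
have realD (x : R[i]) : 0 <= x -> x = ((complex.Re x)%:C)%C.
  by case: x => a b; rewrite lecE /= => /andP[/eqP-> _].
have hD : has_inf D'.
  split; first by exists (complex.Re x0); rewrite /D' /= -realD // D0.
  by exists 0 => r /D0; rewrite lecR.
exists ((inf D')%:C)%C; split.
- by rewrite lecR lb_le_inf //; [exact: hD.1 | move=> r /D0; rewrite lecR].
- move=> x Dx; rewrite (realD _ (D0 _ Dx)) lecR.
  apply: ge_inf; first exact: hD.2.
  by rewrite /D' /= -realD // D0.
- move=> e e0; have eE := realD _ (ltW e0).
  have e0' : 0 < complex.Re e by rewrite -ltcR -eE.
  have [r Dr re] := inf_adherent e0' hD.
  by exists (r%:C)%C => //; rewrite eE -rmorphD /= ltcR.
Qed.

(** Replaces the minimum of two tolerances, since complex scalars are not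
    totally ordered. *)
Lemma positive_lower_bound (d e : S) : 0 < d -> 0 < e ->
  exists c : S, [/\ 0 < c, c <= d & c <= e].
Proof.
move=> d0 e0; have de : 0 < d + e by rewrite addr_gt0.
(* half the harmonic mean lies below both *)
exists (d * e / (d + e)); split; first by rewrite divr_gt0 ?mulr_gt0.
  by rewrite ler_pdivrMr // ler_pM2l // lerDr ltW.
by rewrite ler_pdivrMr // mulrC ler_pM2l // lerDl ltW.
Qed.

Lemma small_eq0 (V : normedModType S) (C : S) (v : V) : 0 <= C ->
  (forall e : S, 0 < e -> `|v| <= C * e) -> v = 0.
Proof.
move=> C0 hv; apply/eqP; rewrite -normr_eq0; apply/negPn/negP => v0.
have vp : 0 < `|v| by rewrite lt_def v0 normr_ge0.
have C1 : 0 < C + 1 by rewrite ltr_wpDl.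
have := hv (`|v| / (C + 1)) (divr_gt0 vp C1).
rewrite mulrCA ler_pMr // ler_pdivlMr // mul1r => h.
by have := lt_le_trans (ltr_pwDr ltr01 (lexx C)) h; rewrite ltxx.
Qed.

End Scalars.

(** * Geometry of an inner product *)

Section Geometry.
Variables (R : realType) (k : scalar_kind) (V : hilbert R k).
Implicit Types u v w : V.

Lemma hdotC u v : <| u, v |> = scalar_conj R k <| v, u |>.
Proof. by rewrite (hermC (hdot V)) /= expr0 mul1r. Qed.

Lemma hdotZl c u v : <| c *: u, v |> = c * <| u, v |>.
Proof. by rewrite linearZl_LR. Qed.

Lemma hdotZr c u v : <| u, c *: v |> = scalar_conj R k c * <| u, v |>.
Proof. by rewrite linearZr_LR. Qed.

Lemma parallelogram u v :
  `|u - v| ^+ 2 + `|u + v| ^+ 2 = `|u| ^+ 2 *+ 2 + `|v| ^+ 2 *+ 2.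
Proof.
rewrite !hdot_norm !linearDl /= !linearDr /= !linearNl /= !linearNr /=. ring.
Qed.

(** Subtracting the component along [v] lowers the squared norm by exactly the
    amount which yields both Cauchy-Schwarz and the orthogonality of a
    nearest-point residual. *)
Lemma norm_sub_proj u v : v != 0 ->
  `|u - (<| u, v |> / `|v| ^+ 2) *: v| ^+ 2 =
  `|u| ^+ 2 - `|<| u, v |>| ^+ 2 / `|v| ^+ 2.
Proof.
move=> v0; have n0 : `|v| ^+ 2 != 0 by rewrite sqrf_eq0 normr_eq0.
set a := <| u, v |>; rewrite hdot_norm linearBl !linearBr /= !hdotZr !hdotZl.
rewrite -!hdot_norm -/a.
have cv : scalar_conj R k (a / `|v| ^+ 2) = scalar_conj R k a / `|v| ^+ 2.
  by rewrite rmorphM fmorphV /= !(hdot_norm v) -(hdotC v v).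
rewrite cv (hdotC v u) -/a -scalar_conjM.
by rewrite divfK // opprB addrA subrK (mulrC (scalar_conj R k a)) mulrAC.
Qed.

Lemma cauchy_schwarz u v : `|<| u, v |>| <= `|u| * `|v|.
Proof.
have [->|v0] := eqVneq v 0; first by rewrite linear0r !normr0 mulr0.
have np : 0 < `|v| ^+ 2 by rewrite exprn_gt0 // normr_gt0.
rewrite -(@ler_pXn2r _ 2) ?nnegrE ?mulr_ge0 // exprMn -ler_pdivrMr //.
by rewrite -subr_ge0 -norm_sub_proj // exprn_ge0.
Qed.

Lemma hdot_inj u v : (forall w, <| u, w |> = <| v, w |>) -> u = v.
Proof.
move=> h; apply/eqP; rewrite -subr_eq0 -normr_eq0 -sqrf_eq0 hdot_norm.
by rewrite linearBl /= h subrr.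
Qed.

End Geometry.

(** * Total families of vectors *)

Section Families.
Variables (R : realType) (k : scalar_kind).
Implicit Types V W : hilbert R k.
Local Notation S := (scalar R k).

(** Linear combinations are indexed by lists of pairs of a coefficient and an
    index, so that a sum of combinations is a concatenation, and the same list
    can be evaluated in two families at once. *)
Definition comb V I (e : I -> V) (s : seq (S * I)) : V :=
  \sum_(p <- s) p.1 *: e p.2.

Definition comb_scale I (c : S) (s : seq (S * I)) :=
  [seq (c * p.1, p.2) | p <- s].

Lemma comb_cat V I (e : I -> V) s t : comb e (s ++ t) = comb e s + comb e t.
Proof. exact: big_cat. Qed.

Lemma comb_scaleE V I (e : I -> V) c s :
  comb e (comb_scale c s) = c *: comb e s.
Proof.
rewrite /comb big_map scaler_sumr; apply: eq_bigr => p _ /=.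
by rewrite scalerA.
Qed.

Lemma comb1 V I (e : I -> V) i : comb e [:: (1, i)] = e i.
Proof. by rewrite /comb big_seq1 scale1r. Qed.

Lemma comb_linear V W I (e : I -> V) (T : {linear V -> W}) s :
  T (comb e s) = comb (T \o e) s.
Proof. by rewrite /comb linear_sum; apply: eq_bigr => p _; rewrite linearZ. Qed.

Lemma lin_spanE V I (e : I -> V) : lin_span (range e) = range (comb e).
Proof.
apply/seteqP; split => [v [n [c [w [hw ->]]]]|_ [s _ <-]].
  have /choice[i hi] : forall j, exists i, e i = w j.
    by move=> j; have [i _ <-] := hw j; exists i.
  exists [seq (c j, i j) | j <- index_enum 'I_n] => //.
  by rewrite /comb big_map; apply: eq_bigr => j _ /=; rewrite hi.
exists (size s), (fun j => (tnth (in_tuple s) j).1),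
  (fun j => e (tnth (in_tuple s) j).2); split; first by move=> j; eexists.
by rewrite /comb big_tnth.
Qed.

Definition total V I (e : I -> V) : Prop :=
  forall v (eps : S), 0 < eps -> exists s, `|v - comb e s| < eps.

Lemma totalP V I (e : I -> V) :
  closure (lin_span (range e)) = setT <-> total e.
Proof.
rewrite lin_spanE; split=> [h v eps eps0|h].
  have : closure (range (comb e)) v by rewrite h.
  move=> /(_ _ (nbhsx_ballx v eps eps0)) [] //.
  by move=> _ [[s _ <-]]; rewrite -ball_normE; exists s.
apply/seteqP; split=> // v _ B /nbhs_ballP[eps eps0 hB].
have [s hs] := h v eps eps0; exists (comb e s); split; first by exists s.
by apply: hB; rewrite -ball_normE.
Qed.

Lemma bop_ext V W (T T' : bop V W) : (forall v, T v = T' v) -> T = T'.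
Proof.
case: T T' => [f bf] [g bg] /= fg.
have e : f = g.
  case: f g {bf bg} fg => f [[f1] [f2]] [g [[g1] [g2]]] /= fg.
  have e : f = g by exact/funext.
  by subst g; rewrite (Prop_irrelevance f1 g1) (Prop_irrelevance f2 g2).
by subst g; rewrite (Prop_irrelevance bf bg).
Qed.

End Families.

(** * Orthogonality and density *)

Section Completeness.
Variables (R : realType) (k : scalar_kind).
Implicit Types V W : hilbert R k.
Local Notation S := (scalar R k).

(** Cauchy's criterion for a family of sets shrinking with a scalar tolerance;
    this form needs neither sequences nor the archimedean property of the
    scalars. *)
Lemma shrinking_limit V (F : S -> set V) :
  (forall d : S, 0 < d -> F d !=set0) ->
  (forall d d', d <= d' -> F d `<=` F d') ->
  (forall eps : S, 0 < eps -> exists2 d : S, 0 < d &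
     forall v w, F d v -> F d w -> `|v - w| < eps) ->
  exists l : V, forall eps : S, 0 < eps -> exists2 d : S, 0 < d &
    forall v, F d v -> `|l - v| < eps.
Proof.
move=> F0 Fmono Fcauchy.
pose G := [set B : set V | exists2 d : S, 0 < d & F d `<=` B].
have GF : ProperFilter G.
  apply: Build_ProperFilter_ex => [B [d /F0 [v Fv] sB]|].
    by exists v; exact: sB.
  split.
  - by exists 1.
  - move=> B C [d d0 sB] [e e0 sC].
    have [c [c0 cd ce]] := positive_lower_bound d0 e0.
    exists c => // v Fv; split; first by apply: sB; apply: Fmono Fv.
    by apply: sC; apply: Fmono Fv.
  - by move=> B C BC [d d0 sB]; exists d => //; exact: subset_trans BC.
have Gc : cauchy G.
  apply: cauchy_exP => eps eps0; have [d d0 hd] := Fcauchy _ eps0.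
  have [v Fv] := F0 d d0; exists v; exists d => // w Fw.
  by rewrite -ball_normE; exact: hd.
have /cvg_ex[l Gl] := @cauchy_cvg _ G GF Gc.
exists l => eps eps0.
have [d d0 sB] : G (ball l eps) by apply: Gl; exact: nbhsx_ballx.
by exists d => // v /sB; rewrite -ball_normE.
Qed.

(** The projection theorem in the form used here. Combinations whose squared
    distance to [v] is nearly the infimum [d] are close to each other, because
    the parallelogram law involves their midpoint, which is no closer than
    [d]. Their limit [l] has [v - l] orthogonal to the family, for otherwise
    [norm_sub_proj] would produce a combination closer than [d]; hence
    [v = l]. *)
Lemma total_orthogonal V I (e : I -> V) :
  (forall v, (forall i, <| v, e i |> = 0) -> v = 0) -> total e.
Proof.
move=> orth v.
pose D := [set x : S | exists s, x = `|v - comb e s| ^+ 2].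
have [d [d0 dmin dinf]] : exists d : S, [/\ 0 <= d, forall x, D x -> d <= x &
    forall e, 0 < e -> exists2 x, D x & x < d + e].
  apply: nonneg_infimum; first by exists (`|v - comb e [::]| ^+ 2), [::].
  by move=> _ [s ->]; exact: exprn_ge0.
have {}dmin s : d <= `|v - comb e s| ^+ 2 by apply: dmin; exists s.
pose F (eps : S) :=
  [set w : V | exists2 s, w = comb e s & `|v - w| ^+ 2 < d + eps].
have F0 (eps : S) : 0 < eps -> F eps !=set0.
  by move=> /dinf[_ [s ->] hs]; exists (comb e s), s.
have Fmono (eps eps' : S) : eps <= eps' -> F eps `<=` F eps'.
  by move=> le w [s -> hs]; exists s => //; rewrite (lt_le_trans hs) ?lerD2l.
have close (eps : S) w w' : F eps w -> F eps w' -> `|w - w'| ^+ 2 < eps *+ 4.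
  move=> [s -> hs] [t -> ht].
  have := parallelogram (v - comb e t) (v - comb e s).
  have -> : v - comb e t - (v - comb e s) = comb e s - comb e t.
    by rewrite opprB addrC addrA subrK.
  have -> : v - comb e t + (v - comb e s) =
      2 *: (v - comb e (comb_scale (2^-1) (s ++ t))).
    rewrite comb_scaleE comb_cat scalerBr scalerA divff ?pnatr_eq0 // scale1r.
    by rewrite scaler_nat mulr2n addrACA -opprD (addrC (comb e t)).
  move: (dmin (comb_scale 2^-1 (s ++ t))); rewrite normrZ exprMn normr_nat.
  move: hs ht; move: (`|_| ^+ 2) (`|_| ^+ 2) (`|_| ^+ 2) (`|_| ^+ 2) => x y z u.
  move=> hx hy hz /(canRL (addrK _)) ->.
  (* twice the bound for each combination, minus the midpoint contribution *)
  have -> : eps *+ 4 = (d + eps) *+ 2 + (d + eps) *+ 2 - 2 ^+ 2 * d.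
    by ring.
  apply: ltr_leD; first by rewrite ltrD ?ltr_pMn2r.
  by rewrite lerN2 ler_pM2l // exprn_gt0.
have [l hl] : exists l : V, forall eps : S, 0 < eps -> exists2 c : S, 0 < c &
    forall w, F c w -> `|l - w| < eps.
  apply: (shrinking_limit F0 Fmono) => eps eps0.
  exists (eps ^+ 2 / 4) => [|w w' Fw Fw']; first by rewrite divr_gt0 ?exprn_gt0.
  rewrite -(@ltr_pXn2r _ 2) ?nnegrE ?(ltW eps0) //.
  have := close _ _ _ Fw Fw'.
  by rewrite -[X in _ < X]mulr_natr divfK // pnatr_eq0.
have vl : v = l.
  apply/subr0_eq/orth => i; apply: (@small_eq0 _ _ _ (`|e i| *+ 2)).
    by rewrite mulrn_wge0.
  move=> eps eps0; have eps2 : 0 < eps ^+ 2 by exact: exprn_gt0.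
  have [c c0 hc] := hl _ eps0.
  have [w [Fc Fe]] : exists w, F c w /\ F (eps ^+ 2) w.
    have [b [b0 bc be]] := positive_lower_bound c0 eps2.
    have [w Fw] := F0 b b0; exists w.
    by split; [apply: Fmono bc _ Fw | apply: Fmono be _ Fw].
  have {Fe}[s ws hw] := Fe.
  (* near-minimality of [w] makes [v - w] nearly orthogonal to [e i] *)
  have lw : `|<| v - w, e i |>| <= eps * `|e i|.
    have [->|ei0] := eqVneq (e i) 0; first by rewrite linear0r !normr0 mulr0.
    have np : 0 < `|e i| ^+ 2 by rewrite exprn_gt0 // normr_gt0.
    rewrite -(@ler_pXn2r _ 2) ?nnegrE ?mulr_ge0 ?(ltW eps0) //.
    rewrite exprMn -ler_pdivrMr //.
    have := norm_sub_proj (v - w) ei0; set t := _ / _.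
    have -> : v - w - t *: e i = v - comb e (s ++ [:: (t, i)]).
      by rewrite comb_cat ws /comb big_seq1 opprD addrA.
    move=> E; have := dmin (s ++ [:: (t, i)]); rewrite E.
    rewrite lerBrDl => h; rewrite -(lerD2l d); apply: le_trans (ltW hw).
    by rewrite addrC.
  rewrite -(subrK w v) -addrA linearDl /= mulr2n mulrDl.
  apply: le_trans (ler_normD _ _) _; apply: lerD; first by rewrite mulrC.
  apply: le_trans (cauchy_schwarz _ _) _; rewrite mulrC ler_wpM2l //.
  by rewrite distrC ltW // hc.
move=> eps eps0; have [c c0 hc] := hl _ eps0.
by have [w Fw] := F0 c c0; have [s ws _] := Fw; exists s; rewrite -ws vl hc.
Qed.

End Completeness.

(** * Operators determined by a total family *)

Section Extension.
Variables (R : realType) (k : scalar_kind).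
Implicit Types V W : hilbert R k.
Local Notation S := (scalar R k).

Lemma is_adjoint_sym V W (T : bop V W) (T' : bop W V) :
  is_adjoint T T' -> is_adjoint T' T.
Proof. by move=> h w v; rewrite hdotC -h -hdotC. Qed.

Lemma bop_eq_total V W I (e : I -> V) (T T' : bop V W) :
  total e -> (forall i, T (e i) = T' (e i)) -> T = T'.
Proof.
move=> et h; apply: bop_ext => v; apply/subr0_eq.
have [M M0 hM] := bop_bounded T; have [M' M'0 hM'] := bop_bounded T'.
apply: (@small_eq0 _ _ _ (M + M')); first exact: addr_ge0.
move=> eps /[dup] eps0 /(et v)[s vs].
have -> : T v - T' v = T (v - comb e s) - T' (v - comb e s).
  have E : T (comb e s) = T' (comb e s).
    by rewrite !comb_linear; apply: eq_bigr => p _ /=; rewrite h.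
  by rewrite (linearB T) (linearB T') /= E opprB addrA subrK.
apply: le_trans (ler_normB _ _) _; rewrite mulrDl.
apply: lerD; [apply: le_trans (hM _) _ | apply: le_trans (hM' _) _].
  by rewrite ler_wpM2l // ltW.
by rewrite ler_wpM2l // ltW.
Qed.

Lemma adjoint_eq_total V W I (e : I -> V) (T : bop V W) (T' : bop W V) w :
  total e -> (forall i, <| T (e i), w |> = <| e i, T' w |>) ->
  forall v, <| T v, w |> = <| v, T' w |>.
Proof.
move=> et h v; apply/subr0_eq.
have [M M0 hM] := bop_bounded T.
apply: (@small_eq0 _ _ (S^o) (M * `|w| + `|T' w|)).
  by rewrite addr_ge0 ?mulr_ge0.
move=> eps /[dup] eps0 /(et v)[s vs].
have -> : <| T v, w |> - <| v, T' w |> =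
    <| T (v - comb e s), w |> - <| v - comb e s, T' w |>.
  have E : <| T (comb e s), w |> = <| comb e s, T' w |>.
    rewrite comb_linear /comb !linear_sumlz; apply: eq_bigr => p _ /=.
    by rewrite !hdotZl h.
  by rewrite (linearB T) /= !linearBl /= E opprB addrA subrK.
apply: le_trans (ler_normB _ _) _; rewrite mulrDl.
apply: lerD; apply: le_trans (cauchy_schwarz _ _) _; last first.
  by rewrite mulrC ler_wpM2l // ltW.
by rewrite mulrAC ler_wpM2r // (le_trans (hM _)) // ler_wpM2l // ltW.
Qed.

Lemma adjoint_total V W I J (e : I -> V) (e' : J -> W) (T : bop V W)
    (T' : bop W V) : total e -> total e' ->
  (forall i j, <| T (e i), e' j |> = <| e i, T' (e' j) |>) -> is_adjoint T T'.
Proof.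
move=> et e't h; apply: is_adjoint_sym => w v; move: w.
apply: (adjoint_eq_total e't) => j; rewrite hdotC [RHS]hdotC.
congr (scalar_conj R k _).
by apply/esym; move: v; apply: (adjoint_eq_total et).
Qed.

(** The bound makes the assignment from [comb e s] to [comb e' s] well defined
    and uniformly continuous, so it extends to the closure of the span. The
    graph of the extension is [Lim], the closure of the graph of the
    assignment; [LimB] makes it single-valued and bounded at once. *)
Lemma bounded_extension V W I (e : I -> V) (e' : I -> W) (M : S) :
  0 <= M -> total e -> (forall s, `|comb e' s| <= M * `|comb e s|) ->
  exists T : bop V W, forall i, T (e i) = e' i.
Proof.
move=> M0 et hM.
pose Lim v w := forall eps : S, 0 < eps ->
  exists s, `|v - comb e s| <= eps /\ `|w - comb e' s| <= eps.
have hMB s t : `|comb e' s - comb e' t| <= M * `|comb e s - comb e t|.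
  have := hM (s ++ comb_scale (-1) t).
  by rewrite !comb_cat !comb_scaleE !scaleN1r.
have LimE v : exists w, Lim v w.
  pose F (d : S) := [set w | exists2 s, w = comb e' s & `|v - comb e s| < d].
  have F0 (d : S) : 0 < d -> F d !=set0.
    by move=> /(et v)[s hs]; exists (comb e' s), s.
  have Fmono (d d' : S) : d <= d' -> F d `<=` F d'.
    by move=> le w [s -> hs]; exists s => //; exact: lt_le_trans le.
  have [w hw] : exists w : W, forall eps : S, 0 < eps -> exists2 d : S, 0 < d &
      forall w', F d w' -> `|w - w'| < eps.
    apply: (shrinking_limit F0 Fmono) => eps eps0.
    have M1 : 0 < M + 1 by rewrite ltr_wpDl.
    exists (eps / (M + 1) / 2); first by rewrite !divr_gt0.
    move=> _ _ [s -> hs] [t -> ht]; apply: le_lt_trans (hMB _ _) _.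
    have : `|comb e s - comb e t| < eps / (M + 1).
      rewrite [ltRHS]splitr; apply: le_lt_trans (ler_distD v _ _) _.
      by rewrite distrC ltrD // distrC.
    rewrite ltr_pdivlMr // mulrC => h; apply: le_lt_trans h.
    by rewrite ler_wpM2r // lerDl.
  exists w => eps eps0; have [d d0 hd] := hw eps eps0.
  have [c [c0 cd ce]] := positive_lower_bound d0 eps0.
  have [s hs] := et v c c0; exists s.
  split; first by rewrite (le_trans (ltW hs)).
  by apply/ltW/hd; exists s => //; exact: lt_le_trans cd.
have LimL c u v w z : Lim u w -> Lim v z -> Lim (c *: u + v) (c *: w + z).
  move=> uw vz eps eps0; have c1 : 0 < `|c| + 1 by rewrite ltr_wpDl.
  have [s [s1 s2]] := uw _ (divr_gt0 eps0 c1).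
  have [t [t1 t2]] := vz _ (divr_gt0 eps0 c1).
  have key (Z : hilbert R k) (a b a' b' : Z) :
    `|a - a'| <= eps / (`|c| + 1) -> `|b - b'| <= eps / (`|c| + 1) ->
    `|c *: a + b - (c *: a' + b')| <= eps.
    move=> ha hb; rewrite opprD addrACA -scalerBr.
    apply: le_trans (ler_normD _ _) _; rewrite normrZ.
    have -> : eps = `|c| * (eps / (`|c| + 1)) + eps / (`|c| + 1).
      by rewrite -[X in _ + X]mul1r -mulrDl mulrCA divff ?mulr1 // gt_eqF.
    by rewrite lerD // ler_wpM2l.
  exists (comb_scale c s ++ t); rewrite !comb_cat !comb_scaleE.
  by split; exact: key.
have LimB v w : Lim v w -> `|w| <= M * `|v|.
  move=> vw; apply/ler_addgt0Pr => eps eps0.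
  have M1 : 0 < M + 1 by rewrite ltr_wpDl.
  have [s [s1 s2]] := vw _ (divr_gt0 eps0 M1).
  rewrite -(subrK (comb e' s) w); apply: le_trans (ler_normD _ _) _.
  have h1 : `|comb e' s| <= M * `|v| + M * (eps / (M + 1)).
    apply: le_trans (hM _) _; rewrite -mulrDr ler_wpM2l //.
    rewrite -{1}(subrK v (comb e s)) addrC; apply: le_trans (ler_normD _ _) _.
    by rewrite lerD2l distrC.
  apply: le_trans (lerD s2 h1) _.
  rewrite addrCA lerD2l -[X in X + _]mul1r -mulrDl addrC mulrCA divff ?mulr1 //.
  by rewrite gt_eqF.
have Lim_uniq v w w' : Lim v w -> Lim v w' -> w = w'.
  move=> vw vw'; apply/esym/subr0_eq/eqP; rewrite -normr_le0.
  have := LimB _ _ (LimL (-1) _ _ _ _ vw vw').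
  by rewrite !scaleN1r addNr normr0 mulr0 addrC.
have [T hT] := choice LimE.
have Tlin : linear T.
  by move=> c u v; apply: Lim_uniq (hT _) (LimL _ _ _ _ _ (hT u) (hT v)).
pose Tl : {linear V -> W} := HB.pack T (GRing.isLinear.Build S V W *:%R T Tlin).
have Tb : exists2 N : S, 0 <= N & forall v, `|Tl v| <= N * `|v|.
  by exists M => // v; exact: LimB.
exists (Bop Tb) => i; apply: Lim_uniq (hT _) _ => eps eps0.
by exists [:: (1, i)]; rewrite !comb1 !subrr !normr0 ltW.
Qed.

(** Equal inner products make the correspondence between the two families
    isometric in both directions, so both extensions exist and are mutually
    inverse. *)
Lemma unitary_of_gram V W I (e : I -> V) (e' : I -> W) :
  total e -> total e' ->
  (forall i j, <| e i, e j |> = <| e' i, e' j |>) ->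
  exists2 U : bop V W, unitary U & forall i, U (e i) = e' i.
Proof.
move=> et e't gram.
have isom s : `|comb e s| = `|comb e' s|.
  apply/eqP; rewrite -(@eqrXn2 _ 2) // !hdot_norm /comb !linear_sumlz /=.
  apply/eqP; apply: eq_bigr => p _; rewrite !linear_sumr; apply: eq_bigr => q _.
  by rewrite /= !hdotZl !hdotZr gram.
have [U UE] : exists U : bop V W, forall i, U (e i) = e' i.
  by apply: (bounded_extension ler01 et) => s; rewrite mul1r isom.
have [U' UE'] : exists U : bop W V, forall i, U (e' i) = e i.
  by apply: (bounded_extension ler01 e't) => s; rewrite mul1r isom.
(* the identity as a bounded operator, to compare with the two composites *)
have one (Z : hilbert R k) : exists N : bop Z Z, forall z, N z = z.
  have h : exists2 N : S, 0 <= N &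
      forall z : Z, `|(idfun : {linear Z -> Z}) z| <= N * `|z|.
    by exists 1 => // z; rewrite mul1r.
  by exists (Bop h).
exists U => //; exists U'; split.
- by apply: (adjoint_total et e't) => i j; rewrite UE UE' gram.
- have [N NE] := one V => v; rewrite -[RHS]NE.
  suff -> : N = U' \oB U by [].
  by apply: (bop_eq_total et) => i /=; rewrite NE UE UE'.
- have [N NE] := one W => v; rewrite -[RHS]NE.
  suff -> : N = U \oB U' by [].
  by apply: (bop_eq_total e't) => i /=; rewrite NE UE' UE.
Qed.

End Extension.

(** * Finitely supported sections *)

Section Sections.
Variables (R : realType) (k : scalar_kind) (X : Type) (H : X -> hilbert R k).
Local Notation S := (scalar R k).
Local Notation allX := [set: {classic X}].
Implicit Types (g : forall x, H x) (W : hilbert R k).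

Definition finite_support g := finite_set [set x | g x != 0].

Lemma fsum_within (D : set {classic X}) (Z : zmodType) (f : X -> Z) :
  finite_set D -> (forall x, ~ D x -> f x = 0) ->
  \sum_(x \in allX) f x = \sum_(x <- fset_set D) f x.
Proof.
move=> Dfin f0; rewrite -(fsbig_widen D) ?fsbig_finite // => x [_ /=].
exact: f0.
Qed.

Lemma norm_fsum W (T : forall x, bop (H x) W) g : finite_support g ->
  `|\sum_(x \in allX) T x (g x)| ^+ 2 =
  \sum_(x \in allX) \sum_(y \in allX) <| T y (g y), T x (g x) |>.
Proof.
move=> gfin.
have g0 (x : X) : ~ [set x | g x != 0] x -> g x = 0 by move=> /negP/negPn/eqP.
have z0 (x : X) : ~ [set x | g x != 0] x -> T x (g x) = 0.
  by move=> /g0 ->; rewrite linear0.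
rewrite hdot_norm !(fsum_within gfin) //; last first.
  move=> x /z0 ->; apply: fsbig1 => y _; exact: linear0r.
rewrite linear_sumr; apply: eq_bigr => x _.
rewrite (fsum_within gfin) //=; last by move=> y /z0 ->; rewrite linear0l.
by rewrite linear_sumlz.
Qed.

Definition single (x : X) (h : H x) : forall y, H y := fun y =>
  match pselect (x = y) with
  | left e => eq_rect x (fun z => H z : Type) h y e
  | right _ => 0
  end.

Lemma singleE (x : X) (h : H x) : single h x = h.
Proof.
by rewrite /single; case: pselect => // e; rewrite (Prop_irrelevance e erefl).
Qed.

Lemma single_neq (x y : X) (h : H x) : x <> y -> single h y = 0.
Proof. by rewrite /single; case: pselect. Qed.

(** A combination may use the same point several times; collecting its terms
    point by point gives a single section that represents it under every
    family of operators, in particular under two families simultaneously. *)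
Lemma comb_section (s : seq (S * {x : X & H x})) :
  exists2 g, finite_support g & forall W (T : forall x, bop (H x) W),
    \sum_(x \in allX) T x (g x) = comb (fun p => T (projT1 p) (projT2 p)) s.
Proof.
elim: s => [|[c [x h]] s [g gfin IH]].
  exists (fun=> 0) => [|W T].
    by apply: (@sub_finite_set _ _ set0) => // x /=; rewrite eqxx.
  by rewrite /comb big_nil; apply: fsbig1 => x _; rewrite linear0.
pose g' y := c *: single h y + g y.
have g'0 y : ~ ([set x] `|` [set x | g x != 0]) y -> single h y = 0 /\ g y = 0.
  move=> /not_orP[/= xy /negP/negPn/eqP ->]; split=> //.
  by apply: single_neq => /esym.
have Dfin : finite_set ([set x] `|` [set x | g x != 0]).
  by rewrite finite_setU; split=> //; exact: finite_set1.
exists g' => [|W T].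
  apply: sub_finite_set Dfin => y /=; apply: contra_neqP => /g'0[s0 g0].
  by rewrite /g' s0 g0 scaler0 addr0.
rewrite /comb big_cons /=.
rewrite -[X in _ = _ + X]/(comb (fun p => T (projT1 p) (projT2 p)) s) -IH.
rewrite !(fsum_within Dfin); last 2 first.
- by move=> y /g'0[_ ->]; rewrite linear0.
- by move=> y /g'0[s0 g0]; rewrite /g' s0 g0 scaler0 addr0 linear0.
under eq_bigr do rewrite linearP.
rewrite big_split /= -scaler_sumr; congr (c *: _ + _).
rewrite -(@fsum_within _ _ (fun y => T y (single h y)) Dfin); last first.
  by move=> y /g'0[-> _]; rewrite linear0.
rewrite -(fsbig_widen ([set x] : set {classic X})) ?fsbig_set1 ?singleE //.
by move=> y [_ /= yx]; rewrite single_neq ?linear0 // => /esym.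
Qed.

End Sections.

(** * Transport along equalities of Hilbert spaces *)

Section Transport.
Variables (R : realType) (k : scalar_kind).
Implicit Types U V W : hilbert R k.

Definition transport V W (e : V = W) : V -> W :=
  match e in _ = Z return V -> Z with erefl => id end.

Lemma transport_id V (e : V = V) v : transport e v = v.
Proof. by rewrite (Prop_irrelevance e erefl). Qed.

Lemma transport_trans U V W (e : U = V) (e' : V = W) u :
  transport e' (transport e u) = transport (etrans e e') u.
Proof. by case: _ / e' ; case: _ / e. Qed.

Lemma transport_hdotl V W (e : V = W) v w :
  <| transport e v, w |> = <| v, transport (esym e) w |>.
Proof. by case: _ / e w. Qed.

(** Rewriting form that does not unfold the operators involved. *)
Lemma bop_compE U V W (T : bop V W) (T' : bop U V) u : (T \oB T') u = T (T' u).
Proof. by []. Qed.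

Lemma bop_castE V V' W W' (eV : V = V') (eW : W = W') (T : bop V W) v :
  bop_cast eV eW T v = transport eW (T (transport (esym eV) v)).
Proof. by case: _ / eV v; case: _ / eW. Qed.

End Transport.

(** * Frames and the shift operators *)

Section Frames.
Variables (R : realType) (k : scalar_kind) (G : star_semigroupoid).
Variables (X : Type) (A : left_action G X) (H : X -> hilbert R k).
Variables (HA : invariant_bundle A H) (K : op_kernel H).
Local Notation S := (scalar R k).

Definition frame (B : symb G -> hilbert R k) :=
  forall s (x : fiber A s), bop (H (sval x)) (B s).

Section OneFrame.
Variables (B : symb G -> hilbert R k) (F : frame B).

Definition frame_family s (p : {x : fiber A s & H (sval x)}) : B s :=
  F (projT1 p) (projT2 p).

Definition has_gram := forall s (x y : fiber A s) h h',
  <| F y h, F x h' |> = <| K (sval x) (sval y) h, h' |>.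

Definition total_frame := forall s, total (@frame_family s).

(** The candidate value of the shift operator of [a] on the frame vectors at
    [x]. *)
Definition shifted a (x : fiber A (dom a)) : bop (H (sval x)) (B (cod a)) :=
  bop_cast (HA (svalP x)) erefl (F (fiber_act x)).

Lemma shiftedE a (x : fiber A (dom a)) h :
  shifted x h = F (fiber_act x) (transport (esym (HA (svalP x))) h).
Proof. by rewrite /shifted bop_castE. Qed.

Definition equivariant (Phi : forall a : G, bop (B (dom a)) (B (cod a))) :=
  forall a (x : fiber A (dom a)) h, Phi a (F x h) = shifted x h.

(** Frame vectors over equal points and symbols agree, whatever proofs of
    equality occur; this reduces each identity between transported vectors to
    an identity between points of [X]. *)
Lemma frame_transport s t (est : s = t) (eB : B s = B t) (x : fiber A s)
    (y : fiber A t) (exy : sval x = sval y) Z (e : Z = H (sval x))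
    (e' : Z = H (sval y)) h :
  transport eB (F x (transport e h)) = F y (transport e' h).
Proof.
case: x y e e' exy => [x px] [y py] /= e e' exy.
subst x t; rewrite transport_id (Prop_irrelevance px py).
by rewrite (Prop_irrelevance e e').
Qed.

Lemma frame_transport1 s t (est : s = t) (eB : B s = B t) (x : fiber A s)
    (y : fiber A t) (exy : sval x = sval y) (e : H (sval x) = H (sval y)) h :
  transport eB (F x h) = F y (transport e h).
Proof. exact: (frame_transport est eB exy erefl e). Qed.

Lemma shifted_gram : has_gram -> forall a (x y : fiber A (dom a)) h h',
  <| shifted y h, shifted x h' |> =
  <| bop_cast (HA (svalP y)) (HA (svalP x))
       (K (act (svalP x)) (act (svalP y))) h, h' |>.
Proof.
by move=> gram a x y h h'; rewrite !shiftedE gram bop_castE transport_hdotl.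
Qed.

(** The left-hand side of the bounded shift condition is a squared norm. *)
Lemma shift_norm : has_gram ->
  forall a (g : forall x : fiber A (dom a), H (sval x)), finite_support g ->
  \sum_(x \in [set: {classic fiber A (dom a)}])
    \sum_(y \in [set: {classic fiber A (dom a)}])
      <| bop_cast (HA (svalP y)) (HA (svalP x))
            (K (act (svalP x)) (act (svalP y))) (g y), g x |> =
  `|\sum_(x \in [set: {classic fiber A (dom a)}]) shifted x (g x)| ^+ 2.
Proof.
move=> gram a g gfin; rewrite (norm_fsum (@shifted a) gfin).
by apply: eq_fsbigr => x _; apply: eq_fsbigr => y _; rewrite shifted_gram.
Qed.

(** So is the right-hand side, up to the constant. *)
Lemma frame_norm : has_gram ->
  forall s (g : forall x : fiber A s, H (sval x)), finite_support g ->
  \sum_(x \in [set: {classic fiber A s}])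
    \sum_(y \in [set: {classic fiber A s}])
      <| K (sval x) (sval y) (g y), g x |> =
  `|\sum_(x \in [set: {classic fiber A s}]) F x (g x)| ^+ 2.
Proof.
move=> gram s g gfin; rewrite (norm_fsum (@F s) gfin).
by apply: eq_fsbigr => x _; apply: eq_fsbigr => y _; rewrite gram.
Qed.

Lemma bounded_shift_of_equivariant Phi :
  has_gram -> equivariant Phi -> bounded_shift_type HA K.
Proof.
move=> gram equi a; have [M M0 hM] := bop_bounded (Phi a).
exists (M ^+ 2) => [|g gfin]; first exact: exprn_ge0.
rewrite shift_norm // frame_norm // -exprMn lerXn2r ?nnegrE ?mulr_ge0 //.
apply: le_trans (hM _); rewrite le_eqVlt; apply/orP; left; apply/eqP.
congr `|_|.
have Dfin : finite_set ([set x | g x != 0] : set {classic fiber A (dom a)}).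
  exact: gfin.
have g0 x : ~ [set x | g x != 0] x -> g x = 0 by move=> /negP/negPn/eqP.
rewrite !(fsum_within Dfin) => [|x /g0 ->|x /g0 ->]; rewrite ?linear0 //.
by rewrite linear_sum; apply: eq_bigr => x _; rewrite equi.
Qed.

Lemma shift_bound : has_gram -> bounded_shift_type HA K ->
  forall a, exists2 M : S, 0 <= M &
    forall s : seq (S * {x : fiber A (dom a) & H (sval x)}),
      `|comb (fun p => shifted (projT1 p) (projT2 p)) s| <=
      M * `|comb (@frame_family _) s|.
Proof.
move=> gram bst a; have [M M0 hM] := bst a.
(* [M] bounds squared norms, and [M <= (M + 1) ^+ 2] avoids a square root *)
exists (M + 1) => [|s]; first exact: addr_ge0.
have [g gfin gE] := comb_section s.
rewrite -(gE _ (@shifted a)) -[comb _ s](gE _ (@F (dom a))).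
have := hM g gfin; rewrite shift_norm // frame_norm // => h.
rewrite -(@ler_pXn2r _ 2) ?nnegrE ?mulr_ge0 ?addr_ge0 // (le_trans h) //.
rewrite exprMn ler_wpM2r ?exprn_ge0 //.
have -> : (M + 1) ^+ 2 = M + (M ^+ 2 + M + 1) by ring.
by rewrite lerDl !addr_ge0 ?exprn_ge0.
Qed.

Lemma equivariant_exists : has_gram -> total_frame -> bounded_shift_type HA K ->
  exists Phi, equivariant Phi.
Proof.
move=> gram tot bst.
have exPhi a : exists T : bop (B (dom a)) (B (cod a)),
    forall x h, T (F x h) = shifted x h.
  have [M M0 hM] := shift_bound gram bst a.
  have [T TE] := bounded_extension M0 (tot _) hM.
  by exists T => x h; exact: (TE (existT _ x h)).
by exists (fun a => sval (cid (exPhi a))) => a; exact: svalP (cid (exPhi a)).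
Qed.

Lemma equivariant_uniq Phi Phi' : total_frame ->
  equivariant Phi -> equivariant Phi' -> Phi = Phi'.
Proof.
move=> tot e e'; apply: functional_extensionality_dep => a.
by apply: (bop_eq_total (tot _)) => -[x h]; rewrite /frame_family /= e e'.
Qed.

(** [a^* . y], as a point of the fiber over [dom a] rather than over the equal
    symbol [cod (star a)]. *)
Definition star_act a (y : fiber A (cod a)) : fiber A (dom a) :=
  let ey := etrans (svalP y) (esym (dom_star a)) in
  exist _ (act ey) (etrans (anchor_act ey) (cod_star a)).

Lemma star_actE Phi : equivariant Phi ->
  forall a (y : fiber A (cod a)) h
    (e : H (sval y) = H (sval (star_act y))),
  bop_cast (congr1 B (dom_star a)) (congr1 B (cod_star a))
    (Phi (star a)) (F y h) = F (star_act y) (transport e h).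
Proof.
move=> equi a y h e; rewrite bop_castE.
pose y' : fiber A (dom (star a)) :=
  exist _ (sval y) (etrans (svalP y) (esym (dom_star a))).
rewrite (@frame_transport1 _ _ (esym (dom_star a)) _ y y' erefl erefl).
rewrite equi shiftedE transport_trans.
apply: frame_transport; first exact: cod_star.
by rewrite /=; congr act; exact: Prop_irrelevance.
Qed.

Lemma invariant_kernelE : invariant_kernel HA K ->
  forall a x y (ex : anchor A x = dom a) (ey : anchor A y = cod a) h,
    let ey' := etrans ey (esym (dom_star a)) in
    transport (HA ex) (K (act ex) y h) =
    K x (act ey') (transport (esym (HA ey')) h).
Proof.
move=> inv a x y ex ey h ey'.
by rewrite -[LHS](bop_castE erefl (HA ex)) inv bop_castE.
Qed.

(** Both identities are tested on frame vectors. Multiplicativity becomes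
    [act_mul]; for adjoints, the inner products of frame vectors turn the
    claim into the invariance of the kernel. *)
Lemma star_rep_of_equivariant Phi : invariant_kernel HA K ->
  has_gram -> total_frame -> equivariant Phi -> is_star_rep B Phi.
Proof.
move=> inv gram tot equi; split.
  move=> a b p; apply: (bop_eq_total (tot _)) => -[x h].
  rewrite bop_compE !bop_castE /frame_family /=.
  pose x' : fiber A (dom (mul p)) :=
    exist _ (sval x) (etrans (svalP x) (esym (dom_mul p))).
  rewrite (@frame_transport1 _ _ (esym (dom_mul p)) _ x x' erefl erefl).
  rewrite !equi !shiftedE.
  pose x'' : fiber A (dom a) :=
    exist _ (act (svalP x)) (etrans (anchor_act (svalP x)) (esym p)).
  rewrite (@frame_transport1 _ _ (esym p) _ (fiber_act x) x'' erefl erefl).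
  rewrite equi shiftedE !transport_trans.
  by apply: frame_transport; [exact: cod_mul | exact: act_mul].
move=> a; apply: (adjoint_total (tot _) (tot _)) => -[x h] [y h'].
rewrite /frame_family /= equi shiftedE.
rewrite (star_actE equi h' (esym (HA _))) hdotC [RHS]hdotC !gram.
by rewrite -(invariant_kernelE inv (svalP x)) transport_hdotl.
Qed.

End OneFrame.
End Frames.

(** * Evaluation in a reproducing kernel Hilbert space *)

Section Rkhs.
Variables (R : realType) (k : scalar_kind) (X : Type) (H : X -> hilbert R k).
Variables (K : op_kernel H) (E : rkhs K).

Lemma rk_eval_bounded x :
  exists2 M : scalar R k, 0 <= M & forall f : E, `|rk_eval f x| <= M * `|f|.
Proof.
have [M M0 hM] := bop_bounded (rk_op E x); exists M => // f.
have [->|f0] := eqVneq (rk_eval f x) 0; first by rewrite normr0 mulr_ge0.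
have fp : 0 < `|rk_eval f x| by rewrite normr_gt0.
rewrite -(ler_pM2r fp) -expr2 hdot_norm rk_reproducing.
apply: le_trans (real_ler_norm _) _.
  by rewrite -rk_reproducing -hdot_norm realX // normr_real.
apply: le_trans (cauchy_schwarz _ _) _.
by rewrite [leRHS]mulrAC mulrC ler_wpM2r // (hM (rk_eval f x)).
Qed.

(** A named function, so that it can carry a linear structure. *)
Definition eval_at x (f : E) : H x := rk_eval f x.

Fact eval_at_linear x : linear (eval_at x).
Proof. by move=> c f g; exact: rk_eval_linear. Qed.

HB.instance Definition _ x :=
  GRing.isLinear.Build (scalar R k) E (H x) _ (eval_at x) (eval_at_linear x).

Definition eval_op x : bop E (H x) :=
  @Bop R k E (H x) (eval_at x) (rk_eval_bounded x).

Lemma rk_op_adjoint x : is_adjoint (rk_op E x) (eval_op x).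
Proof.
apply: is_adjoint_sym => f h; exact: rk_reproducing.
Qed.

(** A vector orthogonal to all kernel sections vanishes at every point by the
    reproducing property. *)
Lemma rk_total : total (fun p : {x : X & H x} => rk_op E (projT1 p) (projT2 p)).
Proof.
apply: total_orthogonal => f hf; apply: (@rk_eval_inj _ _ _ _ _ E) => x.
rewrite -[RHS]/(eval_op x 0) linear0; apply: hdot_inj => h.
by rewrite rk_reproducing linear0l; exact: (hf (existT _ x h)).
Qed.

End Rkhs.

(** * The frames of the kernel spaces and of linearisations *)

Section Linearisations.
Variables (R : realType) (k : scalar_kind) (G : star_semigroupoid).
Variables (X : Type) (A : left_action G X) (H : X -> hilbert R k).
Variables (HA : invariant_bundle A H) (K : op_kernel H).

Section RkhsFrame.
Variable RK : forall s : symb G, rkhs (kernel_on A K s).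
Local Notation B := (fun s => rk_space (RK s)).

Definition rk_frame : frame A H B := fun s x => rk_op (RK s) x.

Lemma rk_frame_gram : has_gram K rk_frame.
Proof.
by move=> s x y h h'; rewrite /= -rk_reproducing rk_kernE.
Qed.

Lemma rk_frame_total : total_frame rk_frame.
Proof. by move=> s; exact: rk_total. Qed.

Lemma rk_equivariantP (Phi : forall a : G, bop (RK (dom a)) (RK (cod a))) :
  equivariant HA rk_frame Phi <->
  forall (a : G) (x : fiber A (dom a)),
    bop_cast (HA (svalP x)) erefl (rk_op (RK (cod a)) (fiber_act x)) =
    Phi a \oB rk_op (RK (dom a)) x.
Proof.
split=> [h a x|h a x v]; first by apply: bop_ext => v; rewrite bop_compE h.
by rewrite /shifted h.
Qed.

Section Linearisation.
Variable Phi : forall a : G, bop (RK (dom a)) (RK (cod a)).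
Hypothesis Phi_star : is_star_rep B Phi.
Hypothesis Phi_equi : equivariant HA rk_frame Phi.

Definition rk_lin_op x : bop (H x) (RK (anchor A x)) :=
  rk_op (RK (anchor A x)) (exist _ x erefl).

Lemma rk_lin_opE s (x : fiber A s) (e : anchor A (sval x) = s) h :
  bop_cast erefl (congr1 B e) (rk_lin_op (sval x)) h = rk_frame x h.
Proof.
rewrite bop_castE.
exact: (@frame_transport1 _ _ _ _ _ _ B rk_frame _ _ e _
  (exist _ (sval x) erefl) x erefl erefl).
Qed.

Lemma rk_lin_kernel x y (e : anchor A y = anchor A x) :
  exists2 Vx_adj : bop (B (anchor A x)) (H x),
    is_adjoint (rk_lin_op x) Vx_adj &
    K x y = Vx_adj \oB bop_cast erefl (congr1 B e) (rk_lin_op y).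
Proof.
exists (eval_op (RK (anchor A x)) (exist _ x erefl)).
  exact: (@rk_op_adjoint _ _ _ _ _ (RK _) (exist _ x erefl)).
apply: bop_ext => h; rewrite bop_compE.
rewrite (@rk_lin_opE _ (exist _ y e) e h); apply/esym.
exact: (@rk_kernE _ _ _ _ _ (RK _) (exist _ y e) h (exist _ x erefl)).
Qed.

Lemma rk_lin_equivariant (a : G) x (e : anchor A x = dom a) :
  Phi a \oB bop_cast erefl (congr1 B e) (rk_lin_op x) =
  bop_cast (HA e) (congr1 B (anchor_act e)) (rk_lin_op (act e)).
Proof.
apply: bop_ext => h; rewrite bop_compE (@rk_lin_opE _ (exist _ x e) e h).
rewrite Phi_equi shiftedE.
rewrite [RHS]bop_castE; apply/esym.
apply: (@frame_transport _ _ _ _ _ _ B rk_frame _ _ (anchor_act e) _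
  (exist _ (act e) erefl)).
by rewrite /=; congr act; exact: Prop_irrelevance.
Qed.

Definition rk_linearisation : invariant_linearisation HA K :=
  InvariantLinearisation rk_lin_kernel Phi_star rk_lin_equivariant.

End Linearisation.
End RkhsFrame.

Section LinearisationFrame.
Variable L : invariant_linearisation HA K.
Local Notation B := (lin_space L).

Definition lin_frame : frame A H B := fun s x =>
  bop_cast erefl (congr1 B (svalP x)) (lin_op L (sval x)).

Lemma lin_frameE s (x : fiber A s) (e : anchor A (sval x) = s) h :
  lin_frame x h = transport (congr1 B e) (lin_op L (sval x) h).
Proof. by rewrite /lin_frame bop_castE (Prop_irrelevance (svalP x) e). Qed.

Lemma lin_frame_gram : has_gram K lin_frame.
Proof.
move=> s [x ex] [y ey] h h'; subst s; have [V adj KE] := lin_kernel L ey.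
rewrite (@lin_frameE _ (exist _ y ey) ey).
rewrite (@lin_frameE _ (exist _ x erefl) erefl).
by rewrite hdotC adj -hdotC /= KE bop_compE bop_castE.
Qed.

Lemma lin_frame_equivariant : equivariant HA lin_frame (lin_rep L).
Proof.
move=> a x h; have E := lin_equivariant L (svalP x).
rewrite -[LHS]bop_compE E shiftedE bop_castE.
by rewrite (@lin_frameE _ (fiber_act x) (anchor_act (svalP x))).
Qed.

Lemma minimalP : minimal L <-> total_frame lin_frame.
Proof.
suff E s : [set v : B s | exists (x : fiber A s) (h : H (sval x)),
    v = bop_cast erefl (congr1 B (svalP x)) (lin_op L (sval x)) h] =
    range (@frame_family _ _ _ _ _ _ _ lin_frame s).
  split=> h s; last by rewrite E; apply/totalP/h.
  by apply/totalP; rewrite -E; exact: h.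
apply/seteqP; split=> [_ [x [h ->]]|_ [[x h] _ <-]]; last by exists x, h.
by exists (existT _ x h).
Qed.

End LinearisationFrame.

Lemma unitarily_equivalent_minimal (L L' : invariant_linearisation HA K) :
  minimal L -> minimal L' -> unitarily_equivalent L L'.
Proof.
move=> /minimalP tot /minimalP tot'.
have exU s : exists2 U : bop (lin_space L s) (lin_space L' s),
    unitary U & forall x h, U (lin_frame L x h) = lin_frame L' x h.
  have [|U uU UE] := unitary_of_gram (tot s) (tot' s).
    by move=> -[x h] [y h']; rewrite /frame_family !lin_frame_gram.
  by exists U => // x h; exact: (UE (existT _ x h)).
pose U s := s2val (cid2 (exU s)); have UE s := s2valP' (cid2 (exU s)).
exists U; split=> [s|a|x]; first exact: s2valP (cid2 (exU s)).
  apply: (bop_eq_total (tot _)) => -[x h]; rewrite /frame_family /=.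
  by rewrite lin_frame_equivariant UE lin_frame_equivariant !shiftedE UE.
apply: bop_ext => h.
have := UE _ (exist _ x erefl) h.
by rewrite !(@lin_frameE _ _ (exist _ x erefl) erefl).
Qed.

End Linearisations.

(** * The equivalence *)

Theorem theorem3p14 (R : realType) (k : scalar_kind) (G : star_semigroupoid)
    (X : Type) (A : left_action G X) (H : X -> hilbert R k)
    (HA : invariant_bundle A H) (K : op_kernel H)
    (RK : forall s : symb G, rkhs (kernel_on A K s)) :
  invariant_kernel HA K ->
  partially_pos_semidef A K ->
  [<-> bounded_shift_type HA K;
       exists! Phi : forall a : G, bop (RK (dom a)) (RK (cod a)),
         is_star_rep (fun s => rk_space (RK s)) Phi /\
         forall (a : G) (x : fiber A (dom a)),
           bop_cast (HA a (sval x) (svalP x)) erefl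
             (rk_op (RK (cod a)) (fiber_act x)) =
           Phi a \oB rk_op (RK (dom a)) x;
       exists L : invariant_linearisation HA K,
         minimal L /\
         forall L' : invariant_linearisation HA K,
           minimal L' -> unitarily_equivalent L L'].
Proof.
move=> inv _; have tot := rk_frame_total (RK := RK).
have gram := rk_frame_gram RK.
tfae.
- move=> bst; have [Phi equi] := equivariant_exists gram tot bst.
  exists Phi; split=> [|Phi' [_ /rk_equivariantP equi']].
    split; last exact/rk_equivariantP.
    exact: star_rep_of_equivariant inv gram tot equi.
  exact: equivariant_uniq tot equi equi'.
- move=> [Phi [[star /rk_equivariantP equi] _]].
  exists (rk_linearisation star equi).
  have Lmin : minimal (rk_linearisation star equi).
    apply/minimalP => s v eps eps0; have [t ht] := tot s v eps eps0; exists t.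
    rewrite (_ : comb _ t =
      comb (@frame_family _ _ _ _ _ _ _ (rk_frame RK) s) t) //.
    by apply: eq_bigr => -[c [x h]] _; congr (_ *: _); exact: rk_lin_opE.
  by split=> // L'; exact: unitarily_equivalent_minimal.
- move=> [L _].
  apply: (bounded_shift_of_equivariant (lin_frame_gram L)).
  exact: lin_frame_equivariant.
Qed.
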